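(* Let $G$ be a connected graph and $k$ an integer with $\mathrm{ipc}(G)\le k$ (respectively $\mathrm{sipc}(G)\le k$). Then: (a) for every integer $r\ge1$, $\mathrm{ipc}(G^r)\le k(4r^2-2r)$ (respectively $\mathrm{sipc}(G^r)\le k(4r^2-2r)$); (b) if $G$ has at least one edge, $\mathrm{ipc}(L(G))\le 3k+1$ (respectively $\mathrm{sipc}(L(G))\le 3k+1$). Moreover, for every integer $t\ge1$ there exists a connected graph $H_t$ with $\mathrm{ipc}(H_t)=t$ and $\mathrm{ipc}(L(H_t))=2t-1$.
   Context: An isometric path is a shortest path; it is $v$-rooted if $v$ is one of its end-vertices. For connected $G$ and $v\in V(G)$, $\mathrm{ipc}_v(G)$ is the minimum $k$ such that the vertices of every isometric path of $G$ can be covered by $k$ many $v$-rooted isometric paths of $G$; $\mathrm{ipc}(G)=\min_v \mathrm{ipc}_v(G)$ (isometric path complexity) and $\mathrm{sipc}(G)=\max_v\mathrm{ipc}_v(G)$ (strong isometric path complexity). For an integer $r\ge1$, $G^r$ is the graph on $V(G)$ in which two distinct vertices are adjacent iff their distance in $G$ is at most $r$. The line graph $L(G)$ has vertex set $E(G)$, two vertices adjacent iff the corresponding edges share an end-vertex. *)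

(* Defs.v *)
From HB Require Import structures.
From mathcomp Require Import all_boot.
From mathcomp Require Import boolp.

Set Implicit Arguments.
Unset Strict Implicit.
Unset Printing Implicit Defensive.

(* When no n satisfies P the value is 0; the uses below on connected graphs
   never reach that case (see path_ex, rooted_cover_ex and ipc_ex). *)
Definition min_nat (P : nat -> Prop) : nat :=
  if pselect (exists n, `[< P n >]) is left exP then ex_minn exP else 0.

Lemma min_natP (P : nat -> Prop) (n : nat) :
  P n -> P (min_nat P) /\ min_nat P <= n.
Proof.
move=> Pn; rewrite /min_nat; case: pselect => [exP|[]]; last first.
  by exists n; apply/asboolP.
case: ex_minnP => m /asboolP Pm le_m; split=> //.
by apply: le_m; apply/asboolP.
Qed.

Lemma eq_min_nat (P Q : nat -> Prop) :
  (forall n, P n <-> Q n) -> min_nat P = min_nat Q.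
Proof. by move=> eqPQ; congr min_nat; apply/funext => n; apply/propext. Qed.

(** Finite simple graphs *)

Record sgraph := SGraph {
  vertex :> finType;
  adj : rel vertex;
  adj_sym : symmetric adj;
  adj_irr : irreflexive adj }.

Definition connected_graph (G : sgraph) : Prop :=
  0 < #|G| /\ forall x y : G, connect (@adj G) x y.

Definition dist (G : sgraph) (x y : G) : nat :=
  min_nat (fun n => exists p : seq G,
    [/\ path (@adj G) x p, last x p = y & size p = n]).

Definition isometric (G : sgraph) (p : seq G) : bool :=
  if p is x :: q then path (@adj G) x q && (size q == dist x (last x q))
  else false.

(* Paths are undirected, so the root may be listed first or last. *)
Definition rooted_isometric (G : sgraph) (v : G) (p : seq G) : bool :=
  isometric p && ((head v p == v) || (last v p == v)).

Definition rooted_cover (G : sgraph) (v : G) (k : nat) : Prop :=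
  forall p : seq G, isometric p ->
    exists ps : k.-tuple (seq G),
      all (rooted_isometric v) ps /\ {subset p <= flatten ps}.

Definition ipc_at (G : sgraph) (v : G) : nat := min_nat (rooted_cover v).

Definition ipc (G : sgraph) : nat :=
  min_nat (fun k => exists v : G, ipc_at v = k).

Definition sipc (G : sgraph) : nat := \max_(v : G) ipc_at v.

(** Well-definedness of the minima on connected graphs *)

Lemma path_ex (G : sgraph) (x y : G) : connected_graph G ->
  exists n, exists p : seq G,
    [/\ path (@adj G) x p, last x p = y & size p = n].
Proof.
by case=> _ /(_ x y) /connectP [p xp ->]; exists (size p), p.
Qed.

Lemma rooted_cover_ex (G : sgraph) (v : G) : connected_graph G ->
  exists k, rooted_cover v k.
Proof.
move=> cG.
have /choice [f fP] : forall x : G,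
    exists p, rooted_isometric v p /\ x \in p.
  move=> x; have [n Pn] := path_ex v x cG.
  have [[p [vp px sp]] _] := min_natP (P := fun n => exists p : seq G,
    [/\ path (@adj G) v p, last v p = x & size p = n]) Pn.
  exists (v :: p); split; last by rewrite -px mem_last.
  by rewrite /rooted_isometric /= eqxx /= vp /= px andbT sp eqxx.
exists (size (map f (enum G))) => p _; exists (in_tuple (map f (enum G))).
split; first by apply/allP => q /mapP [x _ ->]; case: (fP x).
move=> x _; apply/flattenP; exists (f x); last by case: (fP x).
by rewrite map_f ?mem_enum.
Qed.

Lemma ipc_ex (G : sgraph) : connected_graph G ->
  exists k, exists v : G, ipc_at v = k.
Proof. by case=> /card_gt0P [v _] _; exists (ipc_at v), v. Qed.

(** Graph powers *)

Lemma dist_sym (G : sgraph) (x y : G) : dist x y = dist y x.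
Proof.
have half (a b : G) n :
    (exists p : seq G, [/\ path (@adj G) a p, last a p = b & size p = n]) ->
    exists p : seq G, [/\ path (@adj G) b p, last b p = a & size p = n].
  case=> p [ap <- <-]; exists (rev (belast a p)); split.
  - rewrite rev_path; rewrite -(@eq_path _ (@adj G)) // => u w.
    exact: adj_sym.
  - by case: p {ap} => //= c p; rewrite rev_cons last_rcons.
  - by rewrite size_rev size_belast.
by apply: eq_min_nat => n; split; apply: half.
Qed.

Definition power_adj (G : sgraph) (r : nat) : rel G := fun x y => (x != y) && (dist x y <= r).

Lemma power_adj_sym (G : sgraph) (r : nat) : symmetric (@power_adj G r).
Proof. by move=> x y; rewrite /power_adj eq_sym dist_sym. Qed.

Lemma power_adj_irr (G : sgraph) (r : nat) : irreflexive (@power_adj G r).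
Proof. by move=> x; rewrite /power_adj eqxx. Qed.

Definition power (G : sgraph) (r : nat) : sgraph :=
  SGraph (@power_adj_sym G r) (@power_adj_irr G r).

(** Line graphs *)

Definition edges (G : sgraph) : {set {set G}} :=
  [set [set x; y] | x in G, y in G & adj x y].

Definition edge (G : sgraph) : finType := {e : {set G} | e \in edges G}.

Definition line_adj (G : sgraph) : rel (edge G) :=
  fun e f => (e != f) && (val e :&: val f != set0).

Lemma line_adj_sym (G : sgraph) : symmetric (@line_adj G).
Proof. by move=> e f; rewrite /line_adj eq_sym setIC. Qed.

Lemma line_adj_irr (G : sgraph) : irreflexive (@line_adj G).
Proof. by move=> e; rewrite /line_adj eqxx. Qed.

Definition line_graph (G : sgraph) : sgraph :=
  SGraph (@line_adj_sym G) (@line_adj_irr G).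

(* Main.v *)
(* Call x and y aligned towards v when one of them lies on a geodesic from v to the
   other. A set lies on a v-rooted isometric path iff its points are pairwise
   aligned, so covering a geodesic by k rooted paths means colouring its points
   with k colours so that equally coloured points are aligned; this turns the
   whole problem into one about distances.
   Powers: a geodesic of G^r splits into r pieces lying on geodesics of G, and
   vertices aligned in G whose distances to v agree modulo r are aligned in G^r,
   which gives k r^2 <= k (4 r^2 - 2 r).
   Line graphs: a geodesic of L(G) is traced by a geodesic of G, which is monotone
   towards v between the first and the last vertex of a given colour; the edges
   there need two paths, the edge leaving the last vertex needs one more, and the
   first edge of the geodesic yields the + 1.
   Sharpness: two gadgets are joined at their apexes, so that any root sees one of
   them through its apex. The gadget has a zigzag geodesic with 2 t vertices
   alternating between two consecutive levels: a rooted path meets it in at most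
   two vertices, and all its 2 t - 1 edges are at the same distance from a root
   edge. *)
Require Import Defs.
From HB Require Import structures.
From mathcomp Require Import all_boot.
From mathcomp Require Import boolp zify.

Set Implicit Arguments.
Unset Strict Implicit.
Unset Printing Implicit Defensive.

(** * Distances, geodesics, alignment and covers *)

Section Distance.
Variable G : sgraph.
Implicit Types (v x y : G) (p : seq G).

Lemma dist_path x p : path (@adj G) x p -> dist x (last x p) <= size p.
Proof. by move=> xp; apply: (min_natP _).2; exists p. Qed.

Lemma distxx x : dist x x = 0.
Proof. by apply/eqP; rewrite -leqn0 (@dist_path x [::]). Qed.

Lemma dist_adj x y : adj x y -> dist x y <= 1.
Proof. by move=> xy; apply: (@dist_path x [:: y]); rewrite /= xy. Qed.

Hypothesis cG : connected_graph G.

Lemma shortest_path x y :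
  exists p, [/\ path (@adj G) x p, last x p = y & size p = dist x y].
Proof.
have [n Pn] := path_ex x y cG.
by have [] := @min_natP (fun n => exists p : seq G,
  [/\ path (@adj G) x p, last x p = y & size p = n]) n Pn.
Qed.

Lemma dist_eq0 x y : (dist x y == 0) = (x == y).
Proof.
apply/eqP/eqP => [|->]; last exact: distxx.
by have [p [_ <- <-]] := shortest_path x y => /size0nil->.
Qed.

Lemma dist_triangle x y z : dist x z <= dist x y + dist y z.
Proof.
have [p [xp py <-]] := shortest_path x y.
have [q [yq qz <-]] := shortest_path y z.
rewrite -size_cat -qz -py -last_cat; apply: dist_path.
by rewrite cat_path xp py.
Qed.

(** Potentials certify lower bounds on distances; the distances in the witness are bounded from
    below this way. *)
Lemma dist_lipschitz (f : G -> nat) :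
  (forall a b, adj a b -> f b <= f a + 1) ->
  forall x y, f y <= f x + dist x y.
Proof.
move=> f1 x y; have [p [+ + <-]] := shortest_path x y.
elim: p x => [|a p IHp] x /= => [_ ->|/andP[xa ap] py]; first by rewrite addn0.
by have := IHp a ap py; have := f1 _ _ xa; lia.
Qed.

Lemma adj_dist1 x y : dist x y = 1 -> adj x y.
Proof.
have [[|a [|b p]] [//= + <- <-]] := shortest_path x y => //.
by rewrite andbT.
Qed.

Lemma dist_split x y i : i <= dist x y ->
  exists z, dist x z <= i /\ dist z y <= dist x y - i.
Proof.
have [p [xp <- <-]] := shortest_path x y => le_i.
move: xp; rewrite -{1 2}(cat_take_drop i p) cat_path last_cat => /andP[p1 p2].
exists (last x (take i p)); split.
  by apply: leq_trans (dist_path p1) _; rewrite size_takel.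
by apply: leq_trans (dist_path p2) _; rewrite size_drop.
Qed.

Lemma dist_steps (x : nat -> G) r n :
  (forall i, i < n -> dist (x i) (x i.+1) <= r) ->
  forall i j, i <= j -> j <= n -> dist (x i) (x j) <= (j - i) * r.
Proof.
move=> step i j /subnKC <-; move: (j - i) => d; rewrite addKn.
elim: d => [|d IHd] le_n; first by rewrite addn0 distxx.
rewrite addnS in le_n *; apply: leq_trans (dist_triangle _ (x (i + d)) _) _.
by rewrite mulSn addnC leq_add ?step ?IHd // ltnW.
Qed.

(** A shortcut between two points of the path would, by the triangle inequality, also shorten the
    whole path. *)
Lemma isometric_dist x0 p i j : isometric p -> i <= j -> j < size p ->
  dist (nth x0 p i) (nth x0 p j) = j - i.
Proof.
case: p => //= x q /andP[xq /eqP sq] le_ij; rewrite ltnS => lt_j.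
set u := nth x0 (x :: q).
have step l : l < size q -> dist (u l) (u l.+1) <= 1.
  by move=> lt_l; apply: dist_adj; apply: (pathP x0 xq).
have steps := dist_steps step.
have := steps 0 i isT (leq_trans le_ij lt_j).
have := steps _ _ lt_j (leqnn _); have := steps _ _ le_ij lt_j.
have -> : u (size q) = last x q by rewrite (last_nth x0).
have -> : u 0 = x by [].
have := dist_triangle x (u i) (last x q).
by have := dist_triangle (u i) (u j) (last x q); lia.
Qed.

Lemma mkseq_isometric (x : nat -> G) n :
  (forall i, i < n -> adj (x i) (x i.+1)) -> n <= dist (x 0) (x n) ->
  isometric (mkseq x n.+1).
Proof.
move=> xadj le_n; have xp : path (@adj G) (x 0) (map x (iota 1 n)).
  apply/(pathP (x 0)) => i; rewrite size_map size_iota => lt_in.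
  rewrite -[_ :: _]/(map x (iota 0 n.+1)).
  by rewrite !(nth_map 0) ?size_iota ?nth_iota ?add0n ?add1n ?xadj //; lia.
have xl : last (x 0) (map x (iota 1 n)) = x n.
  rewrite (last_nth (x 0)) size_map size_iota -[_ :: _]/(map x (iota 0 n.+1)).
  by rewrite (nth_map 0) ?size_iota // nth_iota.
rewrite /isometric /= xp xl /= size_map size_iota eqn_leq le_n /=.
by rewrite -xl; apply: leq_trans (dist_path xp) _; rewrite size_map size_iota.
Qed.

(** The reverse inequalities are triangle inequalities, so each disjunct is in fact an equality. *)
Definition aligned v x y :=
  (dist v x + dist x y <= dist v y) || (dist v y + dist x y <= dist v x).

Lemma aligned_sym v x y : aligned v x y = aligned v y x.
Proof. by rewrite /aligned orbC (dist_sym x y). Qed.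

Lemma aligned_refl v x : aligned v x x.
Proof. by rewrite /aligned distxx addn0 leqnn. Qed.

Lemma aligned_root v y : aligned v v y.
Proof. by rewrite /aligned distxx leqnn. Qed.

(** Along a path that starts at [v] the distance to [v] is the index; along one that ends at [v] it
    is the index counted from the end. *)
Lemma rooted_aligned v p :
  rooted_isometric v p -> {in p &, forall x y, aligned v x y}.
Proof.
case/andP=> iso_p rp x y xp yp.
rewrite -(nth_index v xp) -(nth_index v yp).
move: xp yp; rewrite -!index_mem.
move: (index x p) (index y p) => i j.
wlog le_ij : i j / i <= j => [wlg|] lti ltj.
  by case/orP: (leq_total i j) => le; [|rewrite aligned_sym]; apply: wlg.
rewrite /aligned (isometric_dist _ iso_p) //.
case/orP: rp => /eqP vp; apply/orP; [left | right].
  have hd l : l < size p -> dist v (nth v p l) = l.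
    by move=> ltl; have := isometric_dist v iso_p (leq0n l) ltl; rewrite nth0 vp subn0.
  by rewrite !hd //; lia.
have hd l : l < size p -> dist v (nth v p l) = (size p).-1 - l.
  move=> ltl; rewrite dist_sym.
  have := @isometric_dist v p l (size p).-1 iso_p; rewrite nth_last vp; apply; lia.
by rewrite !hd //; move: (size p) lti ltj => n; lia.
Qed.

(** Geodesics between consecutive points are concatenated, and their lengths telescope. *)
Lemma geodesic_chain v x s :
  path (fun a b => dist v a + dist a b <= dist v b) x s ->
  exists q, [/\ path (@adj G) x q, last x q = last x s,
    {subset s <= x :: q} & size q + dist v x <= dist v (last x s)].
Proof.
elim: s x => [|b s IHs] x /=; first by exists [::].
case/andP=> xb /IHs [q2 [bq2 q2s sq2 lq2]].
have [q1 [xq1 q1b lq1]] := shortest_path x b.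
exists (q1 ++ q2); split.
- by rewrite cat_path xq1 q1b.
- by rewrite last_cat q1b.
- move=> c; rewrite in_cons => /orP[/eqP -> | /sq2].
    by rewrite -cat_cons mem_cat -q1b mem_last.
  rewrite in_cons -cat_cons mem_cat => /orP[/eqP -> | ->]; last by rewrite orbT.
  by rewrite -q1b mem_last.
- by rewrite size_cat lq1; lia.
Qed.

(** Sorted by distance from [v], with [v] put in front, aligned points form a chain as in
    [geodesic_chain]. *)
Lemma aligned_rooted v (s : seq G) : {in s &, forall x y, aligned v x y} ->
  exists p, rooted_isometric v p /\ {subset s <= p}.
Proof.
move=> s_al; pose leT a b := dist v a <= dist v b.
have leT_tot : total leT by move=> a b; apply: leq_total.
pose s' := v :: sort leT s.
have mem_s' x : x \in sort leT s -> x \in s by rewrite mem_sort.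
have : path (fun a b => dist v a + dist a b <= dist v b) v (sort leT s).
  have : path leT v (sort leT s).
    by have := sort_sorted leT_tot s; case: sort => //= a l ->; rewrite /leT distxx.
  apply: (@sub_in_path _ (mem s')); last first.
    by apply/allP => x.
  move=> a b; rewrite !inE => a_s b_s; rewrite /leT => le_ab.
  have : aligned v a b.
    case/orP: a_s => [/eqP-> | a_s]; first exact: aligned_root.
    case/orP: b_s => [/eqP-> | b_s].
      by rewrite aligned_sym aligned_root.
    by rewrite s_al ?mem_s'.
  by rewrite /aligned; lia.
case/geodesic_chain => q [vq ql sq lq]; exists (v :: q); split.
  rewrite /rooted_isometric /= eqxx andbT vq /= eqn_leq dist_path // andbT.
  by rewrite ql; lia.
by move=> x xs; apply: sq; rewrite mem_sort.
Qed.

(** A point is coloured by the first path of the cover that contains it; conversely,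
    [aligned_rooted] puts each colour class on one rooted path. *)
Lemma rooted_cover_color v k : rooted_cover v k <->
  forall p, isometric p -> exists c : nat -> nat,
    (forall i, i < size p -> c i < k) /\
    (forall i j, i < size p -> j < size p -> c i = c j ->
       aligned v (nth v p i) (nth v p j)).
Proof.
split=> cov p iso_p.
  have [ps [/allP ps_r ps_p]] := cov p iso_p.
  have has_c i : i < size p -> has (fun q => nth v p i \in q) ps.
    move=> lti; have /flattenP[q qps pq] := ps_p _ (mem_nth v lti).
    by apply/hasP; exists q.
  exists (fun i => find (fun q => nth v p i \in q) ps).
  split=> [i /has_c|i j lti ltj eqc]; first by rewrite has_find size_tuple.
  have := nth_find [::] (has_c _ lti); have := nth_find [::] (has_c _ ltj).
  rewrite eqc => jp ip; apply: rooted_aligned ip jp; apply: ps_r.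
  by rewrite mem_nth // -has_find has_c.
have [c [c_k c_al]] := cov p iso_p.
pose X l := [seq nth v p i | i <- iota 0 (size p) & c i == l].
have /choice[P PX] : forall l, exists q, rooted_isometric v q /\ {subset X l <= q}.
  move=> l; apply: aligned_rooted => x y /mapP[i + ->] /mapP[j + ->].
  rewrite !mem_filter !mem_iota !add0n /= => /andP[/eqP il ip] /andP[/eqP jl jp].
  by apply: c_al => //; rewrite il jl.
have sz : size (mkseq P k) == k by rewrite size_mkseq.
exists (Tuple sz); split; first by apply/allP => q /mapP[l _ ->]; case: (PX l).
move=> x xp; apply/flattenP.
have lti : index x p < size p by rewrite index_mem.
exists (P (c (index x p))); first by rewrite map_f // mem_iota c_k.
case: (PX (c (index x p))) => _; apply; apply/mapP; exists (index x p).
  by rewrite mem_filter eqxx mem_iota.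
by rewrite nth_index.
Qed.

Lemma rooted_cover_mono v k l : k <= l -> rooted_cover v k -> rooted_cover v l.
Proof.
move=> le_kl /rooted_cover_color cov; apply/rooted_cover_color => p iso_p.
have [c [c_k c_al]] := cov p iso_p; exists c; split=> // i lti.
exact: leq_trans (c_k i lti) le_kl.
Qed.

(** The root cuts the path into two rooted halves, so two colours suffice for a geodesic through the
    root. *)
Lemma aligned_through v p : isometric p -> v \in p ->
  forall i j, i < size p -> j < size p ->
    (index v p <= i) = (index v p <= j) -> aligned v (nth v p i) (nth v p j).
Proof.
move=> iso_p vp.
have dv l : l < size p ->
    dist v (nth v p l) = (index v p - l) + (l - index v p).
  move=> ltl; rewrite -{1}(nth_index v vp).
  have [le|lt] := leqP (index v p) l.
    by rewrite (isometric_dist _ iso_p) //; lia.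
  by rewrite dist_sym (isometric_dist _ iso_p) ?index_mem //; lia.
move=> i j; wlog le_ij : i j / i <= j => [wlg lti ltj eqi|lti ltj].
  by case/orP: (leq_total i j) => le; [|rewrite aligned_sym]; apply: wlg.
by rewrite /aligned !dv // (isometric_dist _ iso_p) //; lia.
Qed.

Lemma rooted_cover_gt0 v k : rooted_cover v k -> 0 < k.
Proof.
move/rooted_cover_color => /(_ [:: v]) []; first by rewrite /= distxx.
by move=> c [/(_ 0 isT)]; lia.
Qed.

Lemma rooted_cover_ipc_at v k : rooted_cover v k <-> ipc_at v <= k.
Proof.
split=> [cov|]; first exact: (min_natP cov).2.
move/rooted_cover_mono; apply.
by have [n cov] := rooted_cover_ex v cG; exact: (min_natP cov).1.
Qed.

Lemma ipc_leP k : ipc G <= k <-> exists v, rooted_cover v k.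
Proof.
split=> [le_k|[v /rooted_cover_ipc_at]].
  have [n Pn] := ipc_ex cG.
  have [[v vE] _] := @min_natP (fun k => exists v : G, ipc_at v = k) n Pn.
  by exists v; apply/rooted_cover_ipc_at; rewrite vE.
by apply: leq_trans; apply: (min_natP _).2; exists v.
Qed.

Lemma sipc_leP k : sipc G <= k <-> forall v, rooted_cover v k.
Proof.
split=> [/bigmax_leqP le_k v|cov].
  by apply/rooted_cover_ipc_at; apply: le_k.
by apply/bigmax_leqP => v _; apply/rooted_cover_ipc_at.
Qed.

End Distance.

(** Decodes colours that pack a pair into one number. *)
Lemma radix_inj r a b a' b' : b < r -> b' < r ->
  a * r + b = a' * r + b' -> a = a' /\ b = b'.
Proof.
move=> lt_b lt_b' eq_ab; have r_gt0 : 0 < r by lia.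
have := congr1 (divn^~ r) eq_ab; rewrite /= !divnMDl // !divn_small // !addn0.
by move=> eq_a; split=> //; move: eq_ab; rewrite eq_a => /addnI.
Qed.

(** * Graph powers *)

Section Power.
Variables (G : sgraph) (r : nat).
Hypotheses (cG : connected_graph G) (r_gt0 : 0 < r).
Local Notation Gr := (power G r).

Lemma power_walk n (x y : G) : dist x y <= n * r ->
  exists p, [/\ path (@power_adj G r) x p, last x p = y & size p <= n].
Proof.
elim: n x => [|n IHn] x le_n.
  by exists [::]; split=> //; apply/eqP; rewrite -dist_eq0 // -leqn0.
(* The jump covers [minn (dist x y) r]; it is dropped when it is trivial, since the power has no
   loops. *)
have [z [xz zy]] := dist_split cG (geq_minl (dist x y) r).
have [|p [zp py sp]] := IHn z; first by move: le_n; rewrite mulSn; lia.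
have [zx|zx] := eqVneq x z; first by exists p; split; rewrite ?zx //; lia.
exists (z :: p); split=> //=; rewrite zp andbT /power_adj zx /=; lia.
Qed.

Lemma power_connected : connected_graph Gr.
Proof.
split=> [|x y]; first exact: cG.1.
have [|p [xp <- _]] := @power_walk (@dist G x y) x y.
  by rewrite leq_pmulr.
by apply/connectP; exists p.
Qed.

(** In other words, distances are divided by [r] and rounded up. *)
Lemma dist_power n (x y : G) : (@dist Gr x y <= n) = (dist x y <= n * r).
Proof.
apply/idP/idP => [le_n | /power_walk[p [xp <- sp]]]; last first.
  exact: leq_trans (@dist_path Gr _ _ xp) sp.
have [p [+ + sp]] := shortest_path power_connected x y.
rewrite -sp in le_n; elim: p x n le_n {sp} => [|a p IHp] x [|n] //=.
- by move=> _ _ ->; rewrite distxx.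
- by move=> _ _ ->; rewrite distxx.
rewrite ltnS => /IHp IH /andP[/andP[_ xa] ap] py.
by apply: leq_trans (dist_triangle cG x a y) _; rewrite mulSn leq_add ?IH.
Qed.

(** Let the distances from [v] to [x] and [y] be [b * r + m] and [a * r + m] with [b <= a]. Then [y]
    is at most [a - b] jumps from [x], and if [v] reaches [y] in [N] jumps it reaches [x] in
    [N - (a - b)]: the common remainder [m] makes the rounding harmless. *)
Lemma aligned_power (v x y : G) : aligned v x y ->
  dist v x = dist v y %[mod r] -> @aligned Gr v x y.
Proof.
wlog le_xy : x y / dist v x + dist x y <= dist v y => [wlg al eqm|_ eqm].
  case/orP: (al) => le; first exact: wlg le al eqm.
  rewrite aligned_sym; apply: wlg; last exact: esym.
    by rewrite (dist_sym y).
  by rewrite aligned_sym.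
have := divn_eq (dist v x) r; have := divn_eq (dist v y) r.
rewrite eqm; set a := _ %/ r; set b := _ %/ r; set m := _ %% r => ya xb.
apply/orP; left; set N := @dist Gr v y.
have : dist v y <= N * r by rewrite -dist_power.
have le_ba : b <= a by rewrite leq_div2r //; lia.
have xy : @dist Gr x y <= a - b by rewrite dist_power mulnBl; lia.
move=> yN; have le_N : a - b <= N.
  by rewrite -(leq_pmul2r r_gt0) mulnBl; lia.
suff : @dist Gr v x <= N - (a - b) by lia.
by rewrite dist_power !mulnBl; lia.
Qed.

(* The defect [i r - dist (x_0, x_i)] of a geodesic of the power lies in
   [0, r - 1], and its points with equal defect lie on a geodesic of G. *)
Lemma rooted_cover_power (v : G) k :
  rooted_cover v k -> rooted_cover (v : Gr) (r * k * r).
Proof.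
move/(rooted_cover_color cG) => cov.
apply/(rooted_cover_color power_connected) => p iso_p.
pose x i : G := nth (v : Gr) p i; pose def i := i * r - dist (x 0) (x i).
have dx i j : i <= j -> j < size p -> @dist Gr (x i) (x j) = j - i.
  exact: isometric_dist power_connected v p i j iso_p.
have dx_le i j : i <= j -> j < size p -> dist (x i) (x j) <= (j - i) * r.
  by move=> le_ij lt_j; rewrite -dist_power dx.
have dx0_le i : i < size p -> dist (x 0) (x i) <= i * r.
  by move=> lti; rewrite -{2}(subn0 i) dx_le.
(* A point of positive index [i] is not within [i - 1] jumps of [x 0], so its distance from [x 0]
   exceeds [(i - 1) * r]. *)
have def_lt i : i < size p -> def i < r.
  case: i => [|i] lti; first by rewrite /def.
  have : ~~ (@dist Gr (x 0) (x i.+1) <= i) by rewrite dx // subn0 ltnn.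
  by rewrite dist_power -ltnNge /def mulSn; lia.
pose X d := [seq x i | i <- iota 0 (size p) & def i == d].
have /choice[c cP] : forall d, exists c : G -> nat, {in X d, forall y, c y < k} /\
    {in X d &, forall y z, c y = c z -> aligned v y z}.
  (* For equal defects the distances from [x 0] differ by exactly [(j - i) * r], which bounds the
     distance of the two points; so [X d] is aligned towards [x 0]. *)
  move=> d; have [|q [/andP[iso_q _] Xq]] := @aligned_rooted _ cG (x 0) (X d).
    move=> y z /mapP[i + ->] /mapP[j + ->].
    rewrite !mem_filter !mem_iota !add0n /= => /andP[/eqP di lti] /andP[/eqP dj ltj].
    wlog le_ij : i j di dj lti ltj / i <= j => [wlg|].
      by case/orP: (leq_total i j) => le; [|rewrite aligned_sym]; apply: wlg.
    apply/orP; left; move: di dj (dx0_le i lti) (dx0_le j ltj) (dx_le i j le_ij ltj).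
    by rewrite /def mulnBl; have := leq_mul2r r i j; lia.
  have [c [ck cal]] := cov q iso_q; exists (fun y => c (index y q)).
  split=> [y /Xq yq | y z /Xq yq /Xq zq]; first by rewrite ck ?index_mem.
  by move/cal; rewrite !nth_index ?index_mem //; apply.
have xX i : i < size p -> x i \in X (def i).
  by move=> lti; apply/mapP; exists i; rewrite // mem_filter eqxx mem_iota.
(* The colour packs the defect, the colour on the geodesic for that defect, and the distance from
   [v] modulo [r]. *)
exists (fun i => (def i * k + c (def i) (x i)) * r + dist v (x i) %% r).
split=> [i lti | i j lti ltj].
  have ci := (cP (def i)).1 _ (xX i lti); have di := def_lt i lti.
  have mi := ltn_pmod (dist v (x i)) r_gt0.
  have le1 : (def i).+1 * k <= r * k by rewrite leq_mul2r di orbT.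
  have le2 : (def i * k + c (def i) (x i)).+1 * r <= r * k * r.
    by rewrite leq_mul2r; move: le1; rewrite mulSn; lia.
  by move: le2; rewrite mulSn; lia.
case/(radix_inj (ltn_pmod _ r_gt0) (ltn_pmod _ r_gt0)) => + eqm.
have ci := (cP (def i)).1 _ (xX i lti); have cj := (cP (def j)).1 _ (xX j ltj).
case/(radix_inj ci cj) => eqd eqc; apply: aligned_power => //.
have xj : x j \in X (def i) by rewrite eqd xX.
by apply: (cP (def i)).2; rewrite ?xX // eqc eqd.
Qed.

End Power.

(** The distance from [v] changes by at most 1 per step; alignment of the ends makes the total
    change equal to the number of steps, so all steps go by 1 in the same direction. *)
Lemma aligned_monotone (G : sgraph) (cG : connected_graph G) (u : nat -> G) n :
  (forall i j, i <= j -> j < n -> dist (u i) (u j) = j - i) ->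
  forall v i l, i <= l -> l < n -> aligned v (u i) (u l) ->
    (forall h h', i <= h -> h <= h' -> h' <= l ->
       dist v (u h') = dist v (u h) + (h' - h)) \/
    (forall h h', i <= h -> h <= h' -> h' <= l ->
       dist v (u h) = dist v (u h') + (h' - h)).
Proof.
move=> du v i l le_il lt_l.
have tri h : i <= h -> h <= l -> [/\ dist v (u l) <= dist v (u h) + (l - h),
    dist v (u h) <= dist v (u l) + (l - h), dist v (u h) <= dist v (u i) + (h - i)
    & dist v (u i) <= dist v (u h) + (h - i)].
  move=> ih hl; rewrite -(du i h) ?(leq_ltn_trans hl) // -(du h l) //.
  by split; rewrite ?(dist_sym (u h) (u l)) ?(dist_triangle cG) //
     -?(dist_sym (u h) (u l)) ?(dist_sym (u i) (u h)) ?(dist_triangle cG).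
rewrite /aligned (du i l) // => /orP[] le_d; [left | right] => h h' ih hh hl;
  case: (tri h ih (leq_trans hh hl)); case: (tri h' (leq_trans ih hh) hl); lia.
Qed.

(** * Line graphs *)

Section LineGraph.
Variable G : sgraph.
Hypothesis cG : connected_graph G.
Local Notation L := (line_graph G).
Implicit Types (e f : edge G) (x y : G).

Lemma edge_ends e : exists x y, adj x y /\ val e = [set x; y].
Proof.
case: e => e /= /imset2P[x y _ + ->]; rewrite !inE => /andP[_ xy].
by exists x, y.
Qed.

Lemma ex_edge x y : adj x y -> exists e, val e = [set x; y].
Proof.
move=> xy; have exy : [set x; y] \in edges G.
  by apply/imset2P; exists x y; rewrite ?inE.
by exists (exist (fun s : {set G} => s \in edges G) _ exy).
Qed.

Lemma ex_adj : edges G != set0 -> forall v, exists w, @adj G v w.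
Proof.
move=> /set0Pn[s /imset2P[x y _]]; rewrite !inE => /andP[_ xy] _ v.
have [[|w p] [vp vx _]] := shortest_path cG v x; last by case/andP: vp; exists w.
by exists y; rewrite -vx in xy.
Qed.

Lemma edge_eq e x y : x \in val e -> y \in val e -> x != y ->
  adj x y /\ val e = [set x; y].
Proof.
have [a [b [ab ->]]] := edge_ends e; rewrite !inE.
case/orP=> /eqP-> /orP[]/eqP->; rewrite ?eqxx // => _.
by rewrite adj_sym setUC.
Qed.

Lemma edge_dist e x y : x \in val e -> y \in val e -> dist x y <= 1.
Proof.
move=> xe ye; have [->|xy] := eqVneq x y; first by rewrite distxx.
by apply: dist_adj; case: (edge_eq xe ye xy).
Qed.

Lemma line_adjP e f : reflect (exists x, x \in val e /\ x \in val f)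
  ((e == f) || line_adj e f).
Proof.
rewrite /line_adj orb_andr orbN /=; apply: (iffP orP).
  case=> [/eqP->|/set0Pn[x]]; last by rewrite inE => /andP[]; exists x.
  by have [x [y [_ ->]]] := edge_ends f; exists x; rewrite !inE eqxx.
by case=> x [xe xf]; right; apply/set0Pn; exists x; rewrite inE xe.
Qed.

(** The edges of the walk, followed by [f], become the new walk; repetitions are dropped, hence only
    an upper bound. *)
Lemma line_walk e f x p : x \in val e -> path (@adj G) x p -> last x p \in val f ->
  exists q, [/\ path (@line_adj G) e q, last e q = f & size q <= (size p).+1].
Proof.
elim: p e x => [|a p IHp] e x xe /=.
  move=> _ xf; have := introT (line_adjP e f) (ex_intro _ x (conj xe xf)).
  case/orP=> [/eqP->|ef]; first by exists [::].
  by exists [:: f]; rewrite /= ef.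
case/andP=> xa ap pf; have [g gxa] := ex_edge xa.
have [|q [gq qf sq]] := IHp g a _ ap pf; first by rewrite gxa !inE eqxx orbT.
have xg : x \in val g by rewrite gxa !inE eqxx.
have := introT (line_adjP e g) (ex_intro _ x (conj xe xg)).
case/orP=> [/eqP->|eg]; first by exists q; split=> //; apply: leqW.
by exists (g :: q); rewrite /= eg.
Qed.

Lemma line_connected : edges G != set0 -> connected_graph L.
Proof.
move=> /set0Pn[s sG]; split.
  by apply/card_gt0P; exists (exist (fun s : {set G} => s \in edges G) s sG).
move=> e f; have [x [x' [_ ex]]] := edge_ends e; have [y [y' [_ fy]]] := edge_ends f.
have [p [xp py _]] := shortest_path cG x y.
have [||q [eq <- _]] := @line_walk e f x p _ xp.
- by rewrite ex !inE eqxx.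
- by rewrite py fy !inE eqxx.
by apply/connectP; exists q.
Qed.

Lemma dist_line_le e f x y : x \in val e -> y \in val f ->
  @dist L e f <= (dist x y).+1.
Proof.
have [p [xp <- <-]] := shortest_path cG x y => xe yf.
have [q [eq <- sq]] := line_walk xe xp yf.
exact: leq_trans (@dist_path L _ _ eq) sq.
Qed.

Lemma edges_neq0 e : edges G != set0.
Proof. by apply/set0Pn; exists (val e); apply: valP. Qed.

(** Consecutive edges of a geodesic share vertices, and successive shared vertices are ends of one
    edge, so [n] steps yield a distance of at most [n - 1]. *)
Lemma dist_line_ge e f : e != f ->
  exists x y, [/\ x \in val e, y \in val f & (dist x y).+1 <= @dist L e f].
Proof.
have [q [+ + <-]] := shortest_path (line_connected (edges_neq0 e)) e f.
elim: q e => [|g q IHq] e /= => [_ ->|/andP[eg gq] qf _]; first by rewrite eqxx.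
have [x [xe xg]] : exists x, x \in val e /\ x \in val g.
  by apply/line_adjP; rewrite [line_adj _ _]eg orbT.
case: (eqVneq g f) => [gf|/(IHq _ gq qf)[z [y [zg yf le_zy]]]].
  by exists x, x; rewrite -gf distxx.
exists x, y; split=> //; have := dist_triangle cG x z y.
by have := edge_dist xg zg => d t; rewrite ltnS; apply: leq_trans le_zy; lia.
Qed.

Lemma dist_line_ends e f x y : x \in val e -> y \in val f ->
  dist x y <= (@dist L e f).+1.
Proof.
move=> xe yf; have [ef|/dist_line_ge[x' [y' [xe' yf' le_xy]]]] := eqVneq e f.
  by rewrite -ef distxx; rewrite -ef in yf; apply: edge_dist xe yf.
have := edge_dist xe xe'; have := edge_dist yf' yf.
by have := dist_triangle cG x x' y; have := dist_triangle cG x' y' y; lia.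
Qed.

(** The far end [b] never matters: [dist w b >= dist v b - 1 >= dist v a]. *)
Lemma dist_line_end (v w a b : G) e f : val e = [set v; w] ->
  a \in val f -> b \in val f -> dist v a < dist v b -> e != f ->
  @dist L e f = (minn (dist v a) (dist w a)).+1.
Proof.
move=> evw af bf lt_ab ef.
have ve : v \in val e by rewrite evw !inE eqxx.
have we : w \in val e by rewrite evw !inE eqxx orbT.
apply/eqP; rewrite eqn_leq; apply/andP; split.
  by have := dist_line_le ve af; have := dist_line_le we af; lia.
have ab : a != b by apply: contraTneq lt_ab => ->; rewrite ltnn.
have [x [y [+ + le_xy]]] := dist_line_ge ef.
have [_ ->] := edge_eq af bf ab; rewrite evw.
rewrite !inE; have := edge_dist ve we; have := dist_triangle cG v w b.
by move=> t d /orP[]/eqP ex /orP[]/eqP ey; move: le_xy; rewrite ex ey; lia.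
Qed.

(* A geodesic [e_0, ..., e_m] of the line graph is traced by the geodesic
   [u_0, ..., u_(m-1)] of G with [u_i] in both [e_i] and [e_(i+1)]. *)
Lemma line_trace (p : seq L) e0 : @isometric L p -> 1 < size p ->
  exists u : nat -> G, isometric (mkseq u (size p).-1) /\
    forall i, i.+1 < size p ->
      u i \in val (nth e0 p i) /\ u i \in val (nth e0 p i.+1).
Proof.
move=> iso_p; case sp: (size p) => [|[|m]] // _.
have cL := line_connected (edges_neq0 e0).
pose E i : edge G := nth e0 p i.
have dE i j : i <= j -> j < m.+2 -> @dist L (E i) (E j) = j - i.
  by rewrite -sp; apply: isometric_dist.
have /choice[u uE] : forall i, exists x, i.+1 < m.+2 ->
    x \in val (E i) /\ x \in val (E i.+1).
  move=> i; case: (ltnP i.+1 m.+2) => [lti|_]; last first.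
    by have [x _] := edge_ends e0; exists x.
  have := @adj_dist1 L cL (E i) (E i.+1).
  rewrite dE // subSnn => /(_ erefl) Eadj.
  have [x xE] : exists x, x \in val (E i) /\ x \in val (E i.+1).
    by apply/line_adjP; rewrite [line_adj _ _]Eadj orbT.
  by exists x.
exists u; split=> //=; apply: mkseq_isometric => // [i lti|].
  have [ui ui1] := uE i (leqW lti); have [vi1 vi2] := uE i.+1 lti.
  (* If the two coincided, the edges of indices [i] and [i.+2] would share a vertex although their
     distance is 2. *)
  have [uu|] := eqVneq (u i) (u i.+1); last by case/(edge_eq ui1 vi1).
  have := dist_line_le ui vi2; rewrite -uu distxx dE; lia.
have [u0 _] := uE 0 isT; have [_ um] := uE m (ltnSn _).
by have := dist_line_le u0 um; rewrite dE; lia.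
Qed.

(** By [dist_line_end], an edge other than [e] is as far from [e] as its near end is from [v], plus
    1 unless [w] is strictly nearer. The correction is the same for [f] and [g], so it cancels. *)
Lemma aligned_line (v w a b a' b' : G) e f (g : edge G) :
    val e = [set v; w] -> adj v w ->
    a \in val f -> b \in val f -> dist v a < dist v b ->
    a' \in val g -> b' \in val g -> dist v a' < dist v b' ->
    (dist w a < dist v a) = (dist w a' < dist v a') ->
    @dist L f g + dist v a <= dist v a' \/ @dist L f g + dist v a' <= dist v a ->
  @aligned L e f g.
Proof.
move=> evw vw af bf ab ag bg ab' eqw dfg.
have [<-|ef] := eqVneq e f; first exact: aligned_root.
have [<-|eg] := eqVneq e g; first by rewrite aligned_sym aligned_root.
have De := dist_line_end evw af bf ab ef; have De' := dist_line_end evw ag bg ab' eg.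
have vw1 := dist_adj vw; have ta := dist_triangle cG v w a.
have ta' := dist_triangle cG v w a'.
by rewrite /aligned De De'; lia.
Qed.

(* The edge [{u_i, u_(i+1)}] of the trace gets the colour of [u_i] refined by:
   2 if [u_i] is the last vertex of that colour; otherwise the trace is
   monotone towards v between two vertices of this colour, and the edge gets 1
   or 0 according to whether its end nearest to v is strictly nearer to w. *)
Lemma rooted_cover_line (v w : G) e k : val e = [set v; w] -> adj v w ->
  rooted_cover v k -> @rooted_cover L e (3 * k + 1).
Proof.
move=> evw vw /(rooted_cover_color cG) cov.
have cL := line_connected (edges_neq0 e).
apply/(rooted_cover_color cL) => p iso_p.
case: (leqP (size p) 1) => sp.
  exists (fun=> 0); split=> [i _|i j lti ltj _]; first by rewrite addn1.
  have -> : i = 0 by lia.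
  have -> : j = 0 by lia.
  exact: aligned_refl.
have [u [iso_u uE]] := line_trace e iso_p sp.
have [c [c_k c_al]] := cov _ iso_u.
set m := (size p).-1 in iso_u c_k c_al; rewrite size_mkseq in c_k c_al.
have nu i : i < m -> nth v (mkseq u m) i = u i by move=> lti; rewrite nth_mkseq.
have du i j : i <= j -> j < m -> dist (u i) (u j) = j - i.
  move=> le_ij ltj; rewrite -(nu i) ?(leq_ltn_trans le_ij) // -(nu j) //.
  by apply: isometric_dist; rewrite ?size_mkseq.
pose E i : edge G := nth e p i.
have dE i j : i <= j -> j < size p -> @dist L (E i) (E j) = j - i.
  exact: isometric_dist.
pose a i := if dist v (u i) < dist v (u i.+1) then u i else u i.+1.
pose late i := has (fun j => (i < j) && (c j == c i)) (iota 0 m).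
(* For [i = m - 1] the value [u i.+1] is meaningless, but this [i] is never late, so [a i] is not
   consulted. *)
pose col i := if late i then nat_of_bool (dist w (a i) < dist v (a i)) else 2.
have col3 i : col i < 3 by rewrite /col; case: ifP => // _; rewrite ltnS (leq_trans (leq_b1 _)).
exists (fun i => if i is i'.+1 then c i' * 3 + col i' else 3 * k).
split=> [[|i] lti|[|i] [|j] lti ltj].
- by rewrite addn1.
- by have := c_k i; have := col3 i; lia.
- by rewrite aligned_refl.
- by have := c_k j; have := col3 j; lia.
- by have := c_k i; have := col3 i; lia.
case/(radix_inj (col3 i) (col3 j)).
wlog le_ij : i j lti ltj / i <= j => [wlg eqc eqcol|eqc].
  by case/orP: (leq_total i j) => le; [|rewrite aligned_sym]; apply: wlg.
have [->|neq] := eqVneq i j; first by rewrite aligned_refl.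
have lt_ij : i < j by rewrite ltn_neqAle neq.
have ltim : i < m by lia.
have ltjm : j < m by lia.
have late_i : late i by apply/hasP; exists j; rewrite ?mem_iota ?lt_ij /= ?eqc; lia.
(* Equal refinements make [j] late too; a later [l] of the same colour makes the trace monotone on
   an interval that contains [j.+1], hence both edges. *)
rewrite /col late_i; case late_j: (late j); last by case: (_ < _).
have /hasP[l + /andP[lt_jl /eqP cl]] := late_j; rewrite mem_iota => /= ltl.
move=> eqw; have : aligned v (u i) (u l).
  by rewrite -!nu //; apply: c_al => //; rewrite cl.
have ltl' : l < m := ltl.
have le_il : i <= l by apply: ltnW (ltn_trans lt_ij lt_jl).
have lt_ej : j.+2 < size p by rewrite -ltn_predRL (leq_ltn_trans lt_jl).
have lt_ei : i.+2 < size p by apply: leq_trans lt_ej; rewrite 2!ltnS ltnW.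
have [[Ei _] [_ Ei']] := (uE i.+1 lt_ei, uE i lti).
have [[Ej _] [_ Ej']] := (uE j.+1 lt_ej, uE j ltj).
have := dE i.+1 j.+1 le_ij ltj; rewrite subSS => dij al.
(* The near ends are [u i] and [u j] when the distance from [v] increases, [u i.+1] and [u j.+1]
   when it decreases; either way their distances from [v] differ by [j - i]. *)
have [up|down] := aligned_monotone cG du le_il ltl' al.
  have step h : i <= h -> h < l -> dist v (u h) < dist v (u h.+1).
    by move=> le1 le2; rewrite (up h h.+1) // subSnn addn1.
  have [iS jS] := (step i (leqnn _) (ltn_trans lt_ij lt_jl), step j le_ij lt_jl).
  rewrite /a iS jS in eqw; apply: (aligned_line evw vw Ei' Ei iS Ej' Ej jS).
    exact: (can_inj oddb) eqw.
  by left; rewrite [dist _ _]dij (up i j) 1?addnC // ltnW.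
have step h : i <= h -> h < l -> dist v (u h.+1) < dist v (u h).
  by move=> le1 le2; rewrite (down h h.+1) // subSnn addn1.
have [iS jS] := (step i (leqnn _) (ltn_trans lt_ij lt_jl), step j le_ij lt_jl).
rewrite /a !ltnNge (ltnW iS) (ltnW jS) /= -!ltnNge in eqw.
apply: (aligned_line evw vw Ei Ei' iS Ej Ej' jS); first exact: (can_inj oddb) eqw.
by right; rewrite [dist _ _]dij (down i.+1 j.+1) // subSS addnC.
Qed.

End LineGraph.

(** * Sharpness: a single edge for [t = 1], two joined gadgets for larger [t] *)

Definition K2_adj : rel bool := fun x y => x != y.

Lemma K2_adj_sym : symmetric K2_adj. Proof. by case; case. Qed.

Lemma K2_adj_irr : irreflexive K2_adj. Proof. by case. Qed.

Definition K2 : sgraph := SGraph K2_adj_sym K2_adj_irr.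

Lemma K2_connected : connected_graph K2.
Proof.
split; first by rewrite card_bool.
by move=> x y; have [->|xy] := eqVneq x y; rewrite ?connect0 // connect1.
Qed.

Lemma ipc_eq1 (G : sgraph) (v : G) : connected_graph G ->
  (forall x y, aligned v x y) -> ipc G = 1.
Proof.
move=> cG al; apply/eqP; rewrite eqn_leq; apply/andP; split.
  apply/(ipc_leP cG); exists v; apply/(rooted_cover_color cG) => p _.
  by exists (fun=> 0).
have [w cov] := (ipc_leP cG _).1 (leqnn _).
exact: (rooted_cover_gt0 cG cov).
Qed.

Lemma ipc_K2 : ipc K2 = 1.
Proof.
apply: (ipc_eq1 (v := true : K2) K2_connected).
case=> y; first exact: (aligned_root (G := K2)).
case: y; last exact: (aligned_refl (G := K2)).
by rewrite aligned_sym; exact: (aligned_root (G := K2)).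
Qed.

(** The only edge is the whole vertex set, so the line graph has a single vertex. *)
Lemma ipc_line_K2 : ipc (line_graph K2) = 1.
Proof.
have [e _] := @ex_edge K2 true false isT.
apply: (ipc_eq1 (v := e : line_graph K2)).
  exact: (line_connected K2_connected (edges_neq0 e)).
move=> x y; suff -> : x = y by exact: aligned_refl.
have eT (z : edge K2) : val z = [set: K2].
  have [a [b [ab ->]]] := edge_ends z; apply/setP => c; rewrite !inE.
  by case: a b ab c => [] [] // _ [].
by apply: val_inj; rewrite /= !eT.
Qed.

(** Counts pairwise unaligned points of a geodesic, whose colours must differ. *)
Lemma leq_inj_in (c : nat -> nat) n k : (forall i, i < n -> c i < k) ->
  (forall i j, i < n -> j < n -> c i = c j -> i = j) -> n <= k.
Proof.
move=> c_k c_inj; rewrite -(size_iota 0 n) -(size_map c) -(size_iota 0 k).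
apply: uniq_leq_size => [|x /mapP[i + ->]]; last by rewrite !mem_iota => /c_k.
rewrite map_inj_in_uniq ?iota_uniq // => i j.
by rewrite !mem_iota; apply: c_inj.
Qed.

(* The witness for [t = m + 1 >= 2]: two copies, indexed by [bool] and joined by
   an edge between their apexes, of a gadget in which spokes [0, ..., m] of
   length [N + 1] leave the apex [None]; the vertex [Some (i, h)] has level
   [h + 1] on spoke [i], and the end of spoke [i] is also adjacent to the vertex
   of level [N] on spoke [i + 1]. The vertices of levels [N] and [N + 1] form
   a zigzag geodesic. *)
Section Zigzag.
Variable m : nat.
Local Notation N := m.+1.

Definition zvertex : finType := (bool * option ('I_m.+1 * 'I_N.+1))%type.

Definition zup (x y : option ('I_m.+1 * 'I_N.+1)) : bool :=
  match x, y with
  | None, Some (j, h') => h' == 0 :> nat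
  | Some (i, h), Some (j, h') =>
      (h' == h.+1 :> nat) && ((i == j) || (h' == N :> nat) && (i == j.+1 :> nat))
  | _, None => false
  end.

Definition zadj : rel zvertex := fun x y =>
  if x.1 == y.1 then zup x.2 y.2 || zup y.2 x.2
  else (x.2 == None) && (y.2 == None).

Lemma zadj_sym : symmetric zadj.
Proof. by move=> x y; rewrite /zadj eq_sym orbC andbC. Qed.

Lemma zadj_irr : irreflexive zadj.
Proof.
case=> b [[i h]|]; rewrite /zadj eqxx //=.
by rewrite orbb; apply/negP => /andP[/eqP]; lia.
Qed.

Definition zigzag : sgraph := SGraph zadj_sym zadj_irr.

(** Coordinates by plain naturals, meaningful for [i <= m] and [k <= N.+1]; at [k = 0] every [i]
    gives the apex. *)
Definition zv (b : bool) (i k : nat) : zigzag :=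
  (b, if k is h.+1 then Some (inord i, inord h) else None).

Definition level (x : zigzag) : nat := if x.2 is Some (_, h) then h.+1 else 0.

Definition spoke (x : zigzag) : nat := if x.2 is Some (i, _) then i else 0.

Lemma level_zv b i k : k <= N.+1 -> level (zv b i k) = k.
Proof. by case: k => //= k lt_k; rewrite /level /= inordK. Qed.

Lemma spoke_zv b i k : i <= m -> spoke (zv b i k) = if k is 0 then 0 else i.
Proof. by case: k => //= k lt_k; rewrite /spoke /= inordK. Qed.

Lemma spoke_le (x : zigzag) : spoke x <= m.
Proof. by case: x => b [[i h]|] //; rewrite /spoke /= -ltnS. Qed.

Lemma level_le (x : zigzag) : level x <= N.+1.
Proof. by case: x => b [[i h]|] //; rewrite /level /= ltn_ord. Qed.

Lemma zvE (x : zigzag) : x = zv x.1 (spoke x) (level x).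
Proof. by case: x => b [[i h]|] //; rewrite /zv /spoke /level /= !inord_val. Qed.

Lemma zadj_spoke b i k : i <= m -> k <= N -> adj (zv b i k) (zv b i k.+1).
Proof.
move=> le_i le_k; rewrite /= /zadj eqxx /=.
case: k le_k => [|h] le_h /=; first by rewrite inordK.
by rewrite !inordK ?eqxx //; lia.
Qed.

Lemma zadj_cross b i : i < m -> adj (zv b i.+1 N) (zv b i N.+1).
Proof.
by move=> lt_i; rewrite /= /zadj eqxx /= !inordK ?eqxx ?orbT //; lia.
Qed.

Lemma zadj_apex b i j : adj (zv b i 0) (zv (~~ b) j 0).
Proof. by rewrite /= /zadj /=; case: b. Qed.

(** Spares later proofs the case analysis on options and ordinals. *)
Lemma zadj_ind (P : zigzag -> zigzag -> Prop) :
  (forall x y, P x y -> P y x) ->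
  (forall b i k, i <= m -> k <= N -> P (zv b i k) (zv b i k.+1)) ->
  (forall b i, i < m -> P (zv b i.+1 N) (zv b i N.+1)) ->
  P (zv true 0 0) (zv false 0 0) ->
  forall x y, adj x y -> P x y.
Proof.
move=> Psym Pspoke Pcross Papex [b x] [b' y]; rewrite /= /zadj /=.
have [<-|bb'] := eqVneq b b'; last first.
  case/andP=> /eqP-> /eqP->.
  by case: b b' bb' => [] [] // _; apply: Psym.
have up x' y' : zup x' y' -> P (b, x') (b, y').
  case: x' y' => [[i h]|] [[j h']|] //=; last first.
    move=> /eqP h0; have := Pspoke b j 0 (leq_ord j) isT.
    by rewrite /zv inord_val -h0 inord_val.
  case/andP=> /eqP hh /orP[/eqP<-|/andP[/eqP hN /eqP ij]].
    have := Pspoke b i h.+1 (leq_ord i); rewrite -hh leq_ord => /(_ isT).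
    by rewrite hh /zv -hh !inord_val.
  have := Pcross b j; rewrite -ij -ltnS ltn_ord => /(_ isT).
  have hE : inord m = h by apply: val_inj; rewrite /= inordK; lia.
  have hE' : inord N = h' by apply: val_inj; rewrite /= inordK; lia.
  by rewrite /zv hE hE' !inord_val.
by case/orP=> /up // /Psym.
Qed.

Lemma zigzag_connected : connected_graph zigzag.
Proof.
split; first by apply/card_gt0P; exists (zv true 0 0).
have csym : connect_sym (@adj zigzag).
  by apply: sym_connect_sym; exact: (@adj_sym zigzag).
have toapex x : connect (@adj zigzag) (zv x.1 0 0) x.
  rewrite {2}(zvE x); have := level_le x.
  elim: (level x) => [|k IHk] le_k; first exact: connect0.
  apply: connect_trans (IHk (ltnW le_k)) (connect1 _).
  exact: zadj_spoke (spoke_le x) le_k.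
have totrue x : connect (@adj zigzag) (zv true 0 0) x.
  apply: connect_trans (toapex x); case: x.1; first exact: connect0.
  exact/connect1/zadj_apex.
by move=> x y; apply: connect_trans (totrue y); rewrite csym.
Qed.
Local Notation cZ := zigzag_connected.

Lemma spoke_dist b i k k' : i <= m -> k <= k' -> k' <= N.+1 ->
  dist (zv b i k) (zv b i k') <= k' - k.
Proof.
move=> le_i le_k le_k'; rewrite -[leqRHS]muln1.
apply: (dist_steps cZ (x := zv b i) (n := N.+1)) => // h lt_h.
by apply: dist_adj; apply: zadj_spoke.
Qed.

Lemma zigzag_lipschitz (f : zigzag -> nat) :
  (forall b i k, i <= m -> k <= N ->
     f (zv b i k) <= (f (zv b i k.+1)).+1 /\ f (zv b i k.+1) <= (f (zv b i k)).+1) ->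
  (forall b i, i < m ->
     f (zv b i N.+1) <= (f (zv b i.+1 N)).+1 /\
     f (zv b i.+1 N) <= (f (zv b i N.+1)).+1) ->
  f (zv true 0 0) <= (f (zv false 0 0)).+1 ->
  f (zv false 0 0) <= (f (zv true 0 0)).+1 ->
  forall x y, f y <= f x + dist x y.
Proof.
move=> f_spoke f_cross f1 f2; apply: (dist_lipschitz cZ) => a b ab; rewrite addn1.
suff [] : f a <= (f b).+1 /\ f b <= (f a).+1 by [].
move: a b ab; apply: zadj_ind => // [x y [] //|b i lt_i].
by case: (f_cross b i lt_i).
Qed.

(** The vertices that see copy [b] through its apex; [depth] is their distance to that apex. *)
Definition outer b : pred zigzag := [pred x | (x.1 != b) || (x.2 == None)].

Definition depth b (x : zigzag) : nat := if x.1 == b then 0 else (level x).+1.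

Lemma outer_dist b x i k : outer b x -> i <= m -> k <= N.+1 ->
  dist x (zv b i k) = depth b x + k.
Proof.
move=> out_x le_i le_k; apply/eqP; rewrite eqn_leq; apply/andP; split.
  have apex_k : dist (zv b 0 0) (zv b i k) <= k.
    by have := spoke_dist b le_i (leq0n k) le_k; rewrite subn0.
  apply: leq_trans (dist_triangle cZ x (zv b 0 0) _) _; rewrite leq_add //.
  rewrite /depth; move: out_x; rewrite /outer /=.
  have [<- /= /eqP x0|xb _] := eqVneq x.1 b.
    by rewrite {1}(zvE x) /level x0 distxx.
  apply: leq_trans (dist_triangle cZ x (zv x.1 0 0) _) _.
  rewrite -(addn1 (level x)) leq_add //.
    rewrite dist_sym {2}(zvE x).
    by have := spoke_dist x.1 (spoke_le x) (leq0n _) (level_le x); rewrite subn0.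
  have -> : b = ~~ x.1 by move: xb; clear; case: b; case: x.1.
  exact/dist_adj/zadj_apex.
(* The signed distance from the apex of copy [b], negative on the other copy, shifted by [N.+2] to
   stay in the naturals. *)
pose f (y : zigzag) := if y.1 == b then N.+2 + level y else N.+1 - level y.
have : f (zv b i k) <= f x + dist x (zv b i k).
  apply: zigzag_lipschitz => [b' j h _ le_h|b' j lt_j||];
    rewrite /f !level_zv ?leqnSn ?(leqW le_h) //=.
  - by case: (b' == b); lia.
  - by case: (b' == b); lia.
  - by case: (b) => /=; lia.
  - by case: (b) => /=; lia.
rewrite /f /depth eqxx level_zv //; move: out_x; rewrite /outer /=.
case: eqP => /= [_ /eqP|_ _]; last by have := level_le x; lia.
by rewrite /level => ->; lia.
Qed.

Definition tooth b k : zigzag := zv b k./2 (N + odd k).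

Lemma tooth_adj b k : k < (2 * m).+1 -> adj (tooth b k) (tooth b k.+1).
Proof.
move=> lt_k; rewrite /tooth -[k.+1./2]/(uphalf k) uphalf_half oddS.
case: (boolP (odd k)) => ok; rewrite ?add1n ?add0n.
  rewrite -[nat_of_bool (~~ true)]/0 -[nat_of_bool true]/1 addn0 addn1 adj_sym.
  by apply: zadj_cross; lia.
rewrite -[nat_of_bool (~~ false)]/1 -[nat_of_bool false]/0 addn0 addn1.
by apply: zadj_spoke; lia.
Qed.

(** Consecutive teeth are adjacent, so only the distance of the extreme teeth needs a lower
    bound. *)
Lemma tooth_dist b i j : i <= j -> j <= (2 * m).+1 ->
  dist (tooth b i) (tooth b j) = j - i.
Proof.
have steps := dist_steps cZ (x := tooth b) (r := 1) (n := (2 * m).+1)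
  (fun k lt_k => dist_adj (tooth_adj b lt_k)).
(* The potential is [k] at tooth [k]. The minimum with [N + level] lets all spokes meet at the value
   [N] at the apex, and the spokes are long enough for it not to affect the teeth. *)
pose f (x : zigzag) := if (x.1 == b) && (0 < level x) then
  minn (2 * spoke x + ((level x - N) + (N - level x))) (N + level x) else N.
have fE k : k <= (2 * m).+1 -> f (tooth b k) = k.
  move=> le_k; rewrite /f /tooth /= eqxx level_zv; last by case: odd; lia.
  by rewrite spoke_zv; last lia; case: (boolP (odd k)) => ok /=; lia.
have lip : f (tooth b (2 * m).+1) <= f (tooth b 0) + dist (tooth b 0) (tooth b (2 * m).+1).
  apply: zigzag_lipschitz => [b' i' k le_i le_k|b' i' lt_i||]; rewrite /f /=.
  - rewrite !level_zv ?(leqW le_k) // !spoke_zv //; case: (b' == b) => //=.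
    by case: k le_k => [|k] /= le_k; lia.
  - rewrite !level_zv // !spoke_zv //; last lia.
    by case: (b' == b) => //=; lia.
  - by rewrite !andbF.
  - by rewrite !andbF.
rewrite !fE // in lip.
move=> le_ij le_j; have := steps _ _ le_ij le_j; have := steps 0 i isT (leq_trans le_ij le_j).
have := steps _ _ le_j (leqnn _).
have := dist_triangle cZ (tooth b 0) (tooth b i) (tooth b (2 * m).+1).
have := dist_triangle cZ (tooth b i) (tooth b j) (tooth b (2 * m).+1).
by lia.
Qed.

Lemma outer_tooth b x k : outer b x -> k <= (2 * m).+1 ->
  dist x (tooth b k) = depth b x + (N + odd k).
Proof. by move=> out_x le_k; apply: outer_dist => //; lia. Qed.

(** In the copy without the root, the [m.+1] even teeth are equidistant from the root, so no two of
    them are aligned. *)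
Lemma zigzag_cover_ge (v : zigzag) k : rooted_cover v k -> m.+1 <= k.
Proof.
move/(rooted_cover_color cZ); pose b := ~~ v.1.
have out_v : outer b v by rewrite /outer /= /b; case: v.1.
case/(_ (mkseq (tooth b) (2 * m).+2)) => [|c []].
  apply: mkseq_isometric => [i lt_i|]; first exact: tooth_adj.
  by rewrite tooth_dist // subn0.
rewrite size_mkseq => c_k c_al; apply: (@leq_inj_in (fun i => c (2 * i))).
  by move=> i lt_i; apply: c_k; lia.
move=> i j; wlog le_ij : i j / i <= j => [wlg lti ltj eqc|lti ltj eqc].
  by case/orP: (leq_total i j) => le; [|apply/esym]; apply: wlg.
have := c_al (2 * i) (2 * j); rewrite !nth_mkseq; try lia.
have ev l : odd (2 * l) = false by lia.
by rewrite /aligned !(outer_tooth out_v) ?tooth_dist ?ev //; lia.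
Qed.

Lemma zigzag_edges_neq0 : edges zigzag != set0.
Proof. by have [e _] := ex_edge (zadj_apex true 0 0); exact: edges_neq0 e. Qed.
Local Notation cL := (line_connected cZ zigzag_edges_neq0).

(** In a copy that [e] meets at most in its apex, each zigzag edge has an end at level [N], so all
    [2 * m + 1] of them are equidistant from [e]. *)
Lemma zigzag_line_cover_ge (e : edge zigzag) k :
  @rooted_cover (line_graph zigzag) e k -> 2 * m + 1 <= k.
Proof.
move/(rooted_cover_color cL); have [x [x' [xx' ex]]] := edge_ends e.
have xe : x \in val e by rewrite ex !inE eqxx.
pose b := ~~ x.1.
have out_e y : y \in val e -> outer b y.
  have out_x : outer b x by rewrite /outer /= /b; case: x.1.
  rewrite ex !inE => /orP[/eqP->//|/eqP->].
  move: xx'; rewrite /outer /= /zadj /b.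
  case: eqP => [<- _|_ /andP[_ ->]]; last by rewrite orbT.
  by case: x.1.
have /choice[g gE] : forall i, exists f : edge zigzag,
    i <= 2 * m -> val f = [set tooth b i; tooth b i.+1].
  move=> i; case: (leqP i (2 * m)) => le_i; last by exists e.
  by have [f fE] := ex_edge (tooth_adj b (k := i) le_i); exists f.
have g0 i : i <= 2 * m -> tooth b i \in val (g i).
  by move=> le_i; rewrite gE // !inE eqxx.
have g1 i : i <= 2 * m -> tooth b i.+1 \in val (g i).
  by move=> le_i; rewrite gE // !inE eqxx orbT.
have dg i j : i <= j -> j <= 2 * m -> j - i <= @dist (line_graph zigzag) (g i) (g j).
  move=> le_ij le_j; have := dist_line_ends cZ (g0 i (leq_trans le_ij le_j)) (g1 j le_j).
  by rewrite tooth_dist ?(leqW le_ij) // subSn.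
(* The end [y] of [e] that realises the distance to [g i] is at least as near to the even tooth of
   [g j]; exchanging [i] and [j] gives equality. *)
have de i j : i <= 2 * m -> j <= 2 * m ->
    @dist (line_graph zigzag) e (g j) <= @dist (line_graph zigzag) e (g i).
  move=> le_i le_j; have e_gi : e != g i.
    apply: contraTneq xe => ->; rewrite gE // !inE /b.
    by rewrite negb_or -!pair_eqE /= /pair_eq /=; case: x.1.
  have [y [z [ye + le_yz]]] := dist_line_ge cZ e_gi.
  rewrite gE // => zi; have low : depth b y + N <= dist y z.
    by move: zi; rewrite !inE => /orP[]/eqP->; rewrite outer_tooth ?out_e //; lia.
  have [l [ol le_l lj]] : exists l, [/\ odd l = false, l <= (2 * m).+1
      & tooth b l \in val (g j)].
    case: (boolP (odd j)) => oj; last first.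
      by exists j; rewrite (negbTE oj) leqW ?g0.
    by exists j.+1; rewrite /= oj ltnS le_j g1.
  have := dist_line_le cZ ye lj.
  by rewrite outer_tooth ?out_e // ol addn0; lia.
case/(_ (mkseq g (2 * m).+1)) => [|c []].
  apply: mkseq_isometric => [i lt_i|]; last by rewrite -{1}(subn0 (2 * m)) dg.
  have := introT (line_adjP (g i) (g i.+1))
    (ex_intro _ _ (conj (g1 i (ltnW lt_i)) (g0 i.+1 lt_i))).
  case/orP=> // /eqP gg; have := dg i i.+1 (leqnSn i) lt_i.
  by rewrite gg distxx subSnn.
rewrite size_mkseq addn1 => c_k c_al; apply: (leq_inj_in c_k).
move=> i j; wlog le_ij : i j / i <= j => [wlg lti ltj eqc|lti ltj eqc].
  by case/orP: (leq_total i j) => le; [|apply/esym]; apply: wlg.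
have := c_al i j lti ltj eqc; rewrite !nth_mkseq // /aligned.
have := de i j lti ltj; have := de j i ltj lti; have := dg i j le_ij ltj.
by lia.
Qed.

(** * Covers attaining these bounds, rooted at an apex and at the apex edge *)

Lemma apex_outer b b' : outer b (zv b' 0 0).
Proof. by rewrite /outer /= orbT. Qed.

(** A geodesic through the root takes two colours, whence [0 < m]. Any other stays in one copy, as
    the copies are joined only at the root, and is coloured by spokes. *)
Lemma zigzag_cover : 0 < m -> rooted_cover (zv true 0 0) m.+1.
Proof.
move=> m_gt0; apply/(rooted_cover_color cZ) => p iso_p; set v := zv true 0 0.
case: (boolP (v \in p)) => vp.
  exists (fun i => nat_of_bool (index v p <= i)); split=> [i _|i j lti ltj eqc].
    by case: leqP; lia.
  exact: (aligned_through cZ iso_p vp lti ltj (can_inj oddb eqc)).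
pose x i := nth v p i.
have side i : i < size p -> (x i).1 = (x 0).1.
  elim: i => // i IHi lti; rewrite -IHi ?(ltnW lti) //.
  have : adj (x i) (x i.+1).
    by apply: (adj_dist1 cZ); rewrite (isometric_dist cZ v iso_p) ?subSnn.
  have xv h : h < size p -> x h != v.
    by move=> lth; apply: contraNneq vp => <-; rewrite mem_nth.
  have := xv _ lti; have := xv _ (ltnW lti); rewrite /= /zadj /v /zv.
  case: (x i) (x i.+1) => b y [b' y'] /= + +.
  have [//|bb' + + /andP[/eqP y0 /eqP y0']] := eqVneq b b'; rewrite y0 y0'.
  by case: b b' bb' => [] [].
exists (fun i => spoke (x i)); split=> [i _|i j lti ltj eqs]; first by rewrite ltnS spoke_le.
rewrite -/(x i) -/(x j) (zvE (x i)) (zvE (x j)) (side i lti) (side j ltj) -eqs.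
have := level_le (x i); have := level_le (x j); have := spoke_le (x i).
move: (level (x i)) (level (x j)) (spoke (x i)) => k k' s le_s.
wlog le_k : k k' / k <= k' => [wlg le1 le2|le_k' le_k0].
  by case/orP: (leq_total k k') => le; [|rewrite aligned_sym]; apply: wlg.
have := spoke_dist (x 0).1 le_s le_k le_k'.
by rewrite /aligned !(outer_dist (apex_outer _ true)) //; lia.
Qed.

Lemma zigzag_line_cover (e : edge zigzag) : 0 < m ->
  val e = [set zv true 0 0; zv false 0 0] ->
  @rooted_cover (line_graph zigzag) e (2 * m + 1).
Proof.
move=> m_gt0 e_ends; apply/(rooted_cover_color cL) => p iso_p.
case: (boolP ((e : line_graph zigzag) \in p)) => ep.
  exists (fun i => nat_of_bool (index (e : line_graph zigzag) p <= i)).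
  split=> [i _|i j lti ltj eqc]; first by case: leqP; lia.
  exact: (aligned_through cL iso_p ep lti ltj (can_inj oddb eqc)).
(* In copy [b], the edges of a spoke share one of the colours [0, ..., m], and each of the [m] cross
   edges gets its own colour [N + i]. *)
pose Q (f : edge zigzag) b c :=
  (c <= m /\ exists2 k, k <= N & val f = [set zv b c k; zv b c k.+1]) \/
  (exists2 i, i < m & c = N + i /\ val f = [set zv b i.+1 N; zv b i N.+1]).
have Qside f b c y : Q f b c -> y \in val f -> y.1 = b.
  by case=> [[_ [k _ ->]]|[i _ [_ ->]]]; rewrite !inE => /orP[]/eqP->.
have /choice[bc bcQ] : forall f, exists bc : bool * nat, f != e -> Q f bc.1 bc.2.
  move=> f; have [x [y [+ +]]] := edge_ends f; move: x y.
  apply: zadj_ind => [x y IH|b i k le_i le_k fE|b i lt_i fE|fE].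
  - by rewrite setUC.
  - by exists (b, i) => _; left; split=> //; exists k.
  - by exists (b, N + i) => _; right; exists i.
  - by exists (true, 0); rewrite -(inj_eq val_inj) /= fE e_ends eqxx.
pose E i : edge zigzag := nth (e : line_graph zigzag) p i.
have EQ i : i < size p -> Q (E i) (bc (E i)).1 (bc (E i)).2.
  by move=> lti; apply: bcQ; apply: contraNneq ep => <-; rewrite mem_nth.
have side i : i < size p -> (bc (E i)).1 = (bc (E 0)).1.
  elim: i => // i IHi lti; rewrite -IHi ?(ltnW lti) //.
  have Eadj : @adj (line_graph zigzag) (E i) (E i.+1).
    by apply: (adj_dist1 cL); rewrite (isometric_dist cL _ iso_p) ?subSnn.
  have [x [xi xi1]] : exists x, x \in val (E i) /\ x \in val (E i.+1).
    by apply/line_adjP; rewrite [line_adj _ _]Eadj orbT.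
  by rewrite -(Qside _ _ _ _ (EQ _ lti) xi1) (Qside _ _ _ _ (EQ _ (ltnW lti)) xi).
exists (fun i => (bc (E i)).2); split=> [i lti|i j lti ltj eqc].
  by case: (EQ i lti) => [[]|[l] lt_l []]; lia.
have := EQ i lti; have := EQ j ltj; rewrite (side i lti) (side j ltj) -eqc.
rewrite -/(E i) -/(E j); move: (E i) (E j) (bc (E 0)).1 (bc (E i)).2 => f g b c.
case=> [[le_c [k' le_k' gE]]|[l lt_l [-> gE]]]; last first.
  case=> [[]|[l' _ [/addnI<- fE]]]; first lia.
  suff -> : f = g by exact: aligned_refl.
  by apply: val_inj; rewrite fE gE.
case=> [[_ [k le_k fE]]|[l _ []]]; last lia.
(* With the apex of the copy at hand as first end of [e], the second end is never strictly
   nearer. *)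
have {}e_ends : val e = [set zv b 0 0; zv (~~ b) 0 0].
  by case: (b) => //; rewrite e_ends setUC.
move: f g k k' le_k le_k' fE gE.
have main f g k k' : k <= k' -> k' <= N -> val f = [set zv b c k; zv b c k.+1] ->
    val g = [set zv b c k'; zv b c k'.+1] -> @aligned (line_graph zigzag) e f g.
  move=> le_k le_k' fE gE; have [fg|fg] := eqVneq f g; first by rewrite fg aligned_refl.
  have lt_k : k < k'.
    rewrite ltn_neqAle le_k andbT; apply: contraNneq fg => kk.
    by apply/eqP/val_inj; rewrite fE gE kk.
  have f0 : zv b c k \in val f by rewrite fE !inE eqxx.
  have f1 : zv b c k.+1 \in val f by rewrite fE !inE eqxx orbT.
  have g0 : zv b c k' \in val g by rewrite gE !inE eqxx.
  have g1 : zv b c k'.+1 \in val g by rewrite gE !inE eqxx orbT.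
  have d h : h <= N.+1 -> dist (zv b 0 0) (zv b c h) = h.
    by move=> le_h; rewrite outer_dist ?apex_outer // /depth eqxx.
  have d' h : h <= N.+1 -> dist (zv (~~ b) 0 0) (zv b c h) = h.+1.
    by move=> le_h; rewrite outer_dist ?apex_outer // /depth; case: (b).
  have le_k'1 : k' <= N.+1 := leqW le_k'.
  have le_k1 : k <= N.+1 := leq_trans le_k le_k'1.
  have lt_kN : k.+1 <= N.+1 := leq_trans lt_k le_k'1.
  apply: (aligned_line cZ e_ends (zadj_apex b 0 0) f0 f1 _ g0 g1).
  - by rewrite (d k) // (d k.+1).
  - by rewrite (d k') // (d k'.+1).
  - by rewrite (d k) // (d k') // (d' k) // (d' k') // !ltnNge !leqnSn.
  - left; rewrite (d k) // (d k') // -(subnK (ltnW lt_k)) leq_add2r.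
    apply: leq_trans (dist_line_le cZ f1 g0) _.
    by rewrite -(subnSK lt_k) ltnS spoke_dist.
move=> f g k k' le_k le_k' fE gE; case/orP: (leq_total k k') => le_kk.
  exact: main le_kk le_k' fE gE.
by rewrite aligned_sym; apply: main le_kk le_k gE fE.
Qed.

Lemma ipc_zigzag : 0 < m -> ipc zigzag = m.+1.
Proof.
move=> m_gt0; apply/eqP; rewrite eqn_leq; apply/andP; split.
  by apply/(ipc_leP cZ); exists (zv true 0 0); apply: zigzag_cover.
by have [v /zigzag_cover_ge] := (ipc_leP cZ _).1 (leqnn _).
Qed.

Lemma ipc_line_zigzag : 0 < m -> ipc (line_graph zigzag) = 2 * m + 1.
Proof.
move=> m_gt0; apply/eqP; rewrite eqn_leq; apply/andP; split.
  have [e eE] := ex_edge (zadj_apex true 0 0).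
  by apply/(ipc_leP cL); exists e; apply: zigzag_line_cover.
by have [e /zigzag_line_cover_ge] := (ipc_leP cL _).1 (leqnn _).
Qed.

End Zigzag.

Theorem theorem1p8 :
  (forall (G : sgraph) (k : nat), connected_graph G ->
     (ipc G <= k ->
        (forall r : nat, 1 <= r ->
           ipc (power G r) <= k * (4 * r ^ 2 - 2 * r)) /\
        (edges G != set0 -> ipc (line_graph G) <= 3 * k + 1)) /\
     (sipc G <= k ->
        (forall r : nat, 1 <= r ->
           sipc (power G r) <= k * (4 * r ^ 2 - 2 * r)) /\
        (edges G != set0 -> sipc (line_graph G) <= 3 * k + 1))) /\
  (forall t : nat, 1 <= t ->
     exists H : sgraph,
       connected_graph H /\ ipc H = t /\ ipc (line_graph H) = 2 * t - 1).
Proof.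
split=> [G k cG|[|[|m]] // _]; last first.
- have cZ := zigzag_connected m.+1; exists (zigzag m.+1); split=> //.
  by rewrite ipc_zigzag // ipc_line_zigzag //; split=> //; lia.
- by exists K2; rewrite ipc_K2 ipc_line_K2; split; first exact: K2_connected.
have cov_power (v : G) r : 0 < r -> rooted_cover v k ->
    @rooted_cover (power G r) v (k * (4 * r ^ 2 - 2 * r)).
  move=> r_gt0 /(rooted_cover_power cG r_gt0).
  apply: (rooted_cover_mono (power_connected cG r_gt0)).
  (* This is [r * r <= 4 * r ^ 2 - 2 * r], from [1 <= r]. *)
  by rewrite (mulnC r) -mulnA leq_mul2l -mulnn; apply/orP; right; nia.
split=> [/(ipc_leP cG)[v cov]|/(sipc_leP cG) cov]; split=> [r r_gt0|G1].
- by apply/(ipc_leP (power_connected cG r_gt0)); exists v; apply: cov_power.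
(* Any edge at the root [v] can serve as root of the line graph. *)
- have [w vw] := ex_adj cG G1 v; have [e eE] := ex_edge vw.
  apply/(ipc_leP (line_connected cG G1)); exists e.
  exact: (rooted_cover_line cG eE vw cov).
- by apply/(sipc_leP (power_connected cG r_gt0)) => v; apply: cov_power.
- apply/(sipc_leP (line_connected cG G1)) => e.
  have [v [w [vw eE]]] := edge_ends e.
  exact: (rooted_cover_line cG eE vw (cov v)).
Qed.
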